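(* Let $p=2q+1\ge 3$ be an odd integer coprime to $3$, let $T=[(x_1,y_1),\dots,(x_q,y_q)]$ be a strong starter in $\mathbb{Z}_p$ (with its pairs and the elements inside pairs listed in some fixed order), and let $t\in\mathbb{Z}_p$. Let $\Sigma_p=[(u_i,v_i)]_{i=0}^{3q}$ be the extension of $T$ with key $t$. Suppose $(U_i,V_i)_{i=0}^{3q}$, with $U_i,V_i\in\{0,1,2\}$, is a solution of the modular Sudoku problem associated with $(T,t)$. For $i=0,\dots,3q$ let $a_i,b_i\in\mathbb{Z}_{3p}$ be the elements (uniquely determined by the Chinese Remainder Theorem) with $$a_i\equiv u_i \pmod p,\quad a_i\equiv U_i\pmod 3,\quad b_i\equiv v_i\pmod p,\quad b_i\equiv V_i\pmod 3.$$ Then $S=\{\{a_i,b_i\}\}_{i=0}^{3q}$ is a strong starter in $\mathbb{Z}_{3p}$.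
   Context: Starters. For odd $n\ge 3$, $\mathbb{Z}_n=\mathbb{Z}/n\mathbb{Z}$ and $\mathbb{Z}_n^*=\mathbb{Z}_n\setminus\{0\}$. A starter in $\mathbb{Z}_n$ (of order $n$) is a partition of $\mathbb{Z}_n^*$ into $k=(n-1)/2$ pairs $\{a_i,b_i\}$, $i=1,\dots,k$, such that the differences $\pm(a_i-b_i)$, $i=1,\dots,k$, comprise all of $\mathbb{Z}_n^*$. It is strong if the $k$ sums $a_i+b_i\in\mathbb{Z}_n$ are pairwise distinct and all nonzero. Extension. Given $T=[(x_1,y_1),\dots,(x_q,y_q)]$ with entries in $\mathbb{Z}_p$, $p=2q+1$, and a key $t\in\mathbb{Z}_p$, the extension of $T$ with key $t$ is the tuple $\Sigma_p=[(u_i,v_i)]_{i=0}^{3q}$ of ordered pairs in $\mathbb{Z}_p$ given by $(u_0,v_0)=(t,t)$ and, for $1\le i\le q$, $(u_{3i-2},v_{3i-2})=(x_i,y_i)$, $(u_{3i-1},v_{3i-1})=(t+x_i,t+y_i)$, $(u_{3i},v_{3i})=(t-y_i,t-x_i)$. The three pairs with indices $3i-2,3i-1,3i$ form the $i$-th regular row. Weak sets. For $s\in\mathbb{Z}_p$ let $W_s=\{\ell\in\{0,\dots,3q\}: u_\ell+v_\ell=s \text{ in }\mathbb{Z}_p\}$. $W_s$ is called a weak set if $s=0$ or $|W_s|>1$. Monochrome sets. The position $\langle i,0\rangle$ refers to the entry $u_i$ and $\langle i,1\rangle$ to the entry $v_i$, $0\le i\le 3q$. For $c\in\mathbb{Z}_p$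 the monochrome set $M_c$ is the set of positions whose entry in $\Sigma_p$ equals $c$. Modular Sudoku problem associated with $(T,t)$: find $U_i,V_i\in\{0,1,2\}$, $0\le i\le 3q$ (regarded as residues modulo $3$, with $U_i$ in position $\langle i,0\rangle$ and $V_i$ in position $\langle i,1\rangle$), such that: (1) Row constraints: for each $i=1,\dots,q$ the differences $U_j-V_j \bmod 3$, $j=3i-2,3i-1,3i$, are pairwise distinct. (2) Weak set constraints: for each weak set $W_s$ with $s\ne0$, the sums $U_i+V_i\bmod 3$, $i\in W_s$, are pairwise distinct; and the sums $U_i+V_i\bmod 3$, $i\in W_0$, are pairwise distinct and nonzero. (3) Color constraints: for each $c\in\mathbb{Z}_p$, $c\neq0$, the values of the unknowns in the positions belonging to $M_c$ are pairwise distinct; and the values of the unknowns in the positions belonging to $M_0$ are pairwise distinct and nonzero. *)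

(* Defs.v *)
From mathcomp Require Import all_boot all_order all_algebra.

Set Implicit Arguments.
Unset Strict Implicit.
Unset Printing Implicit Defensive.

Import GRing.Theory.
Local Open Scope ring_scope.

(* The bounds on n are part of the definition: 'Z_0 and 'Z_1 both denote the
   integers modulo 2. Letting (a, b) range over both orderings of each pair in
   the fourth clause yields the two differences a - b and b - a. *)
Definition starter (n : nat) (S : {set {set 'Z_n}}) : Prop :=
  [/\ odd n && (3 <= n)%N,
      partition S [set~ 0],
      #|S| = (n.-1)./2 /\ (forall B, B \in S -> #|B| = 2%N)
    & \bigcup_(B in S) [set a - b | a in B, b in B & a != b] = [set~ 0]].

Definition pair_sum (n : nat) (B : {set 'Z_n}) : 'Z_n := \sum_(x in B) x.

Definition strong_starter (n : nat) (S : {set {set 'Z_n}}) : Prop :=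
  [/\ starter S,
      {in S &, injective (@pair_sum n)}
    & forall B, B \in S -> pair_sum B != 0].

Section Extension.
Variables (p q : nat) (T : q.-tuple ('Z_p * 'Z_p)) (t : 'Z_p).

(* T is indexed from 0, so the i-th pair of T (0 <= i < q) gives rise to the
   pairs of index 3i+1, 3i+2, 3i+3 of the extension; the default (0, 0) is
   never used. *)
Definition extension (l : 'I_(3 * q).+1) : 'Z_p * 'Z_p :=
  if (l : nat) is m.+1 then
    let: (x, y) := nth (0, 0) T (m %/ 3)%N in
    match (m %% 3)%N with
    | 0 => (x, y)
    | 1 => (t + x, t + y)
    | _ => (t - y, t - x)
    end
  else (t, t).

Definition ext_u (l : 'I_(3 * q).+1) : 'Z_p := (extension l).1.
Definition ext_v (l : 'I_(3 * q).+1) : 'Z_p := (extension l).2.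

Definition regular_row (i : 'I_q) : {set 'I_(3 * q).+1} :=
  [set l : 'I_(3 * q).+1 | (3 * i + 1 <= l <= 3 * i + 3)%N].

Definition sum_set (s : 'Z_p) : {set 'I_(3 * q).+1} :=
  [set l | ext_u l + ext_v l == s].

Definition weak (s : 'Z_p) : bool := (s == 0) || (1 < #|sum_set s|)%N.

(* The position <i, 0> is (i, false) and the position <i, 1> is (i, true). *)
Definition at_position (A : Type) (f g : 'I_(3 * q).+1 -> A)
    (z : 'I_(3 * q).+1 * bool) : A :=
  if z.2 then g z.1 else f z.1.

Definition monochrome (c : 'Z_p) : {set 'I_(3 * q).+1 * bool} :=
  [set z | at_position ext_u ext_v z == c].

Section Sudoku.
Variables U V : 'I_(3 * q).+1 -> 'Z_3.

Definition row_constraints : Prop :=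
  forall i : 'I_q, {in regular_row i &, injective (fun j => U j - V j)}.

Definition weak_set_constraints : Prop :=
  [/\ forall s : 'Z_p, weak s -> s != 0 ->
        {in sum_set s &, injective (fun i => U i + V i)},
      {in sum_set 0 &, injective (fun i => U i + V i)}
    & forall i, i \in sum_set 0 -> U i + V i != 0].

Definition color_constraints : Prop :=
  [/\ forall c : 'Z_p, c != 0 -> {in monochrome c &, injective (at_position U V)},
      {in monochrome 0 &, injective (at_position U V)}
    & forall z, z \in monochrome 0 -> at_position U V z != 0].

Definition sudoku_solution : Prop :=
  [/\ row_constraints, weak_set_constraints & color_constraints].

End Sudoku.
End Extension.

(* Main.v *)
Require Import Defs.
From mathcomp Require Import all_boot all_order all_algebra.

(** A row [(x, y)] of the starter contributes to the extension three pairs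
    with the same difference [x - y] modulo [p]; the row constraint makes the
    three differences distinct modulo 3, so by the Chinese Remainder Theorem
    they are all the elements of [Z_3p] that lie over [x - y].  As the
    differences of a starter, taken with both signs, fill the nonzero residues
    modulo [p], this accounts for every difference that is nonzero modulo [p].
    What remains are the two nonzero multiples of [p]: the pair lying over
    [(t, t)] has a difference that is zero modulo [p] but, by the color
    constraint at [t], nonzero modulo 3, so it yields these two, one for each
    sign ([mem_difference]).

    The rest is a translation of constraints: two entries, or two sums, that
    agree in [Z_3p] agree modulo [p], hence belong to one monochrome set, or
    to one weak set; there the constraint says that they differ modulo 3.  The
    same holds for an entry or a sum that would be zero.

    These facts suffice for a strong starter ([strong_starter_imset]): the
    [2 * (3q + 1) = 3p - 1] entries are distinct and nonzero, so by counting
    they exhaust the nonzero residues. *)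

Section Starters.

Set Implicit Arguments.
Unset Strict Implicit.
Unset Printing Implicit Defensive.

Import GRing.Theory.
Local Open Scope ring_scope.

(** * Strong starters given by families of pairs *)

Lemma pair_sum_set2 n (x y : 'Z_n) : x != y -> pair_sum [set x; y] = x + y.
Proof. by move=> ne_xy; rewrite /pair_sum big_setU1 ?inE //= big_set1. Qed.

Section Criterion.
Variables (n : nat) (I : finType) (a b : I -> 'Z_n).
Hypotheses (n_odd : odd n) (n_ge3 : (3 <= n)%N) (card_I : #|I| = (n.-1)./2).

Definition entry (z : I * bool) : 'Z_n := if z.2 then b z.1 else a z.1.

Hypotheses (entry_inj : injective entry) (entry_neq0 : forall z, entry z != 0).

Local Notation pairs := [set [set a i; b i] | i : I].

Lemma mem_pair x i : (x \in [set a i; b i]) = [exists c, x == entry (i, c)].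
Proof.
rewrite !inE; apply/orP/existsP => [[] h|[[] h]].
- by exists false.
- by exists true.
- by right.
- by left.
Qed.

Lemma pair_neq i : a i != b i.
Proof. by apply/eqP => /(@entry_inj (i, false) (i, true)). Qed.

Lemma pair_inj x i j : x \in [set a i; b i] -> x \in [set a j; b j] -> i = j.
Proof.
rewrite !mem_pair => /existsP[c /eqP->] /existsP[c' /eqP].
by move/entry_inj; case.
Qed.

(** The entries, being distinct and nonzero, exhaust the nonzero residues
    because there are [2 * #|I| = n - 1] of them. *)
Lemma entries_nonzero : [set entry z | z : I * bool] = [set~ 0].
Proof.
apply/eqP; rewrite eqEcard; apply/andP; split.
  by apply/subsetP => x /imsetP[z _ ->]; rewrite !inE entry_neq0.
rewrite card_imset // card_prod card_bool card_I cardsC1.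
rewrite card_ord Zp_cast ?(ltn_trans _ n_ge3) // muln2.
by rewrite even_halfK // -oddS prednK ?(ltn_trans _ n_ge3).
Qed.

Lemma partition_pairs : partition pairs [set~ 0].
Proof.
apply/and3P; split.
- rewrite -entries_nonzero /cover; apply/eqP/setP => x.
  apply/bigcupP/imsetP => [[B /imsetP[i _ ->]]|[[i c] _ ->]].
    by rewrite mem_pair => /existsP[c /eqP->]; exists (i, c).
  exists [set a i; b i]; first exact: imset_f.
  by rewrite mem_pair; apply/existsP; exists c.
- apply/trivIsetP => _ _ /imsetP[i _ ->] /imsetP[j _ ->].
  rewrite -setI_eq0 => ne_ij.
  apply/eqP/setP => x; rewrite in_set0; apply/negP => /setIP[xi xj].
  by case/eqP: ne_ij; rewrite (pair_inj xi xj).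
- by apply/imsetP => -[i _ /setP/(_ (a i))]; rewrite !inE eqxx.
Qed.

(** A difference [d] is only required up to sign, since a pair has no order. *)
Lemma strong_starter_imset :
  (forall d, d != 0 -> exists i, d = a i - b i \/ - d = a i - b i) ->
  injective (fun i => a i + b i) -> (forall i, a i + b i != 0) ->
  strong_starter pairs.
Proof.
move=> diff sum_inj sum_neq0.
have sumE i : pair_sum [set a i; b i] = a i + b i.
  exact/pair_sum_set2/pair_neq.
split.
- split; first by rewrite n_odd.
  + exact: partition_pairs.
  + split; last by move=> _ /imsetP[i _ ->]; rewrite cards2 pair_neq.
    rewrite card_imset // => i j eq_ij.
    have ai : a i \in [set a i; b i] by rewrite set21.
    by apply: pair_inj (ai) _; rewrite -eq_ij.
  + apply/setP => d; rewrite !inE.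
    apply/bigcupP/idP => [[_ /imsetP[i _ ->]] | d_neq0].
      case/imset2P => x y _; rewrite inE => /andP[_ ne_xy] ->.
      by rewrite subr_eq0.
    have [i di] := diff d d_neq0.
    exists [set a i; b i]; first exact: imset_f.
    case: di => di; apply/imset2P.
      by exists (a i) (b i); rewrite ?inE ?eqxx ?orbT //= pair_neq.
    exists (b i) (a i); rewrite ?inE ?eqxx ?orbT //= 1?eq_sym ?pair_neq //.
    by rewrite -[d]opprK di opprB.
- move=> _ _ /imsetP[i _ ->] /imsetP[j _ ->]; rewrite !sumE.
  by move/sum_inj->.
- by move=> _ /imsetP[i _ ->]; rewrite sumE.
Qed.

End Criterion.

Lemma starter_difference n (I : finType) (x y : I -> 'Z_n) :
    starter [set [set x i; y i] | i : I] ->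
  forall d, d != 0 -> exists i, d = x i - y i \/ - d = x i - y i.
Proof.
case=> _ _ _ /setP diff d d_neq0; move: (diff d); rewrite !inE d_neq0.
case/bigcupP => _ /imsetP[i _ ->] /imset2P[u v].
rewrite !inE => /orP[] /eqP-> /andP[/orP[] /eqP-> ne] ->; exists i.
- by rewrite eqxx in ne.
- by left.
- by right; rewrite opprB.
- by rewrite eqxx in ne.
Qed.

(** * Residues modulo [d] of residues modulo [n] *)

Section Reduction.

Definition reduce n d (x : 'Z_n) : 'Z_d := (x : nat)%:R.

Lemma reduceP n d (x : 'Z_n) (y : 'Z_d) :
  (1 < d)%N -> (x = y %[mod d])%N -> reduce d x = y.
Proof.
move=> d_gt1 eq_xy; rewrite /reduce -Zp_nat_mod // eq_xy.
by rewrite Zp_nat_mod // natr_Zp.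
Qed.

Variables (n d : nat).
Hypotheses (n_gt1 : (1 < n)%N) (d_gt1 : (1 < d)%N) (dvd_dn : (d %| n)%N).

Lemma reduceD : {morph @reduce n d : x y / x + y}.
Proof.
move=> x y; rewrite /reduce -natrD.
have -> : (x + y : 'Z_n) = ((x + y) %% n)%N :> nat.
  by rewrite /= [in X in (_ %% X)%N]Zp_cast.
by rewrite -[LHS]Zp_nat_mod // modn_dvdm // Zp_nat_mod.
Qed.

Lemma reduce0 : reduce d (0 : 'Z_n) = 0.
Proof. by []. Qed.

Lemma reduceN : {morph @reduce n d : x / - x}.
Proof. by move=> x; apply/eqP; rewrite -addr_eq0 -reduceD addNr. Qed.

Lemma reduceB : {morph @reduce n d : x y / x - y}.
Proof. by move=> x y; rewrite reduceD reduceN. Qed.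

End Reduction.

(** The injectivity half of the Chinese Remainder Theorem: to identify an
    element of ['Z_(m * n)] it is enough to compare both reductions. *)
Lemma reduce_coprime_inj m n (x y : 'Z_(m * n)) :
    (1 < m)%N -> (1 < n)%N -> coprime m n ->
  reduce m x = reduce m y -> reduce n x = reduce n y -> x = y.
Proof.
move=> m_gt1 n_gt1 co_mn eq_m eq_n; have mn_gt1 : (1 < m * n)%N.
  by rewrite (leq_trans m_gt1) // leq_pmulr // ltnW.
have modE d : (1 < d)%N -> reduce d x = reduce d y -> (x == y %[mod d])%N.
  by move=> d_gt1 /(congr1 val); rewrite /= !val_Zp_nat // => ->.
have lt_mn (z : 'Z_(m * n)) : (z < m * n)%N by rewrite -[X in (_ < X)%N]Zp_cast.
apply: val_inj; apply/eqP; rewrite /= -(modn_small (lt_mn x)).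
by rewrite -(modn_small (lt_mn y)) chinese_remainder // !modE.
Qed.

Lemma Z3_neq0 (x y : 'Z_3) : x != 0 -> y != 0 -> x = y \/ - x = y.
Proof.
by case: x y => [[|[|[|?]]] ?] [[|[|[|?]]] ?] //= _ _;
   do [by left; apply: val_inj | by right; apply: val_inj].
Qed.

(** * The three pairs of a regular row *)

Section Row.
Variables (p q : nat) (T : q.-tuple ('Z_p * 'Z_p)) (t : 'Z_p) (i : 'I_q).

Lemma row_index_subproof (k : 'I_3) : ((3 * i + k).+1 < (3 * q).+1)%N.
Proof.
rewrite ltnS (@leq_trans (3 * i.+1)) ?leq_mul2l ?ltn_ord ?orbT //.
by rewrite mulnS addnC ltn_add2r.
Qed.

Definition row_index (k : 'I_3) : 'I_(3 * q).+1 :=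
  Ordinal (row_index_subproof k).

Lemma row_index_inj : injective row_index.
Proof. by move=> k k' [] /addnI /val_inj. Qed.

Lemma mem_regular_row k : row_index k \in regular_row i.
Proof.
rewrite inE /= addn1 addn3 !ltnS leq_addr -(addn2 (3 * i)) leq_add2l.
exact: ltn_ord k.
Qed.

Lemma ext_difference k :
  ext_u T t (row_index k) - ext_v T t (row_index k) =
    (tnth T i).1 - (tnth T i).2.
Proof.
rewrite /ext_u /ext_v /extension /= (tnth_nth (0, 0)).
rewrite mulnC divnMDl // divn_small ?ltn_ord // addn0.
rewrite modnMDl modn_small ?ltn_ord //.
case: (nth _ _ _) => x y /=; case: k => [[|[|[|?]]] ?] //=.
- by rewrite opprD addrACA subrr add0r.
- by rewrite opprB addrC addrA subrK addrC.
Qed.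

(** The row constraint asks for three distinct values, and ['Z_3] has no
    others. *)
Lemma row_difference (U V : 'I_(3 * q).+1 -> 'Z_3) (e : 'Z_3) :
  row_constraints U V -> exists k, U (row_index k) - V (row_index k) = e.
Proof.
move=> /(_ i) rowUV.
have UV_inj : injective (fun k => U (row_index k) - V (row_index k)).
  move=> k k' eq_k; apply: row_index_inj.
  by apply: rowUV eq_k; apply: mem_regular_row.
have /codomP[k ->] := inj_card_onto UV_inj (leqnn _) e.
by exists k.
Qed.

End Row.

(** * Lifting a starter along a Sudoku solution *)

Section Lifting.
Variables (p q : nat) (T : q.-tuple ('Z_p * 'Z_p)) (t : 'Z_p).
Variables (U V : 'I_(3 * q).+1 -> 'Z_3) (a b : 'I_(3 * q).+1 -> 'Z_(3 * p)).
Hypotheses (p_gt1 : (1 < p)%N) (co_p3 : coprime p 3).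
Hypothesis solUV : sudoku_solution T t U V.
Hypotheses (a_p : forall l, reduce p (a l) = ext_u T t l)
           (a_3 : forall l, reduce 3 (a l) = U l)
           (b_p : forall l, reduce p (b l) = ext_v T t l)
           (b_3 : forall l, reduce 3 (b l) = V l).

Let p3_gt1 : (1 < 3 * p)%N.
Proof. by rewrite (leq_trans p_gt1) // leq_pmull. Qed.

Let dvd_p : (p %| 3 * p)%N. Proof. exact: dvdn_mull. Qed.
Let dvd_3 : (3 %| 3 * p)%N. Proof. exact: dvdn_mulr. Qed.

Let reduce_inj (x y : 'Z_(3 * p)) :
  reduce p x = reduce p y -> reduce 3 x = reduce 3 y -> x = y.
Proof.
by move=> eq_p eq_3; apply: reduce_coprime_inj; rewrite // coprime_sym.
Qed.

Lemma reduce_entry_p z :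
  reduce p (entry a b z) = at_position (ext_u T t) (ext_v T t) z.
Proof. by case: z => l []; rewrite /entry /at_position /= ?a_p ?b_p. Qed.

Lemma reduce_entry_3 z : reduce 3 (entry a b z) = at_position U V z.
Proof. by case: z => l []; rewrite /entry /at_position /= ?a_3 ?b_3. Qed.

Lemma entry_lift_inj : injective (entry a b).
Proof.
move=> z z' eq_z; have [_ _ [col col0 _]] := solUV.
have color_inj c : {in monochrome T t c &, injective (at_position U V)}.
  by have [->|/col] := eqVneq c 0.
apply: (color_inj (reduce p (entry a b z))).
- by rewrite inE reduce_entry_p.
- by rewrite inE eq_z reduce_entry_p.
- by rewrite -!reduce_entry_3 eq_z.
Qed.

Lemma entry_lift_neq0 z : entry a b z != 0.
Proof.
have [_ _ [_ _ col_neq0]] := solUV.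
apply/eqP => z0; have /eqP[] : at_position U V z != 0.
  by apply: col_neq0; rewrite inE -reduce_entry_p z0 reduce0.
by rewrite -reduce_entry_3 z0 reduce0.
Qed.

Lemma reduce_sum_p l : reduce p (a l + b l) = ext_u T t l + ext_v T t l.
Proof. by rewrite reduceD // a_p b_p. Qed.

Lemma reduce_sum_3 l : reduce 3 (a l + b l) = U l + V l.
Proof. by rewrite reduceD // a_3 b_3. Qed.

Lemma sum_lift_inj : injective (fun l => a l + b l).
Proof.
move=> l l' /= eq_l; have [_ [ws ws0 _] _] := solUV.
apply/eqP; apply: contraT => ne_l.
set s := reduce p (a l + b l).
have ls : l \in sum_set T t s by rewrite inE -reduce_sum_p.
have l's : l' \in sum_set T t s by rewrite inE -reduce_sum_p -eq_l.
have weak_s : weak T t s.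
  apply/orP; right; apply/card_gt1P; by exists l, l'.
have UV_inj : {in sum_set T t s &, injective (fun l => U l + V l)}.
  by have [->|] := eqVneq s 0; last exact: ws.
by case/eqP: ne_l; apply: UV_inj => //; rewrite -!reduce_sum_3 eq_l.
Qed.

Lemma sum_lift_neq0 l : a l + b l != 0.
Proof.
have [_ [_ _ ws_neq0] _] := solUV.
apply/eqP => l0; have /eqP[] : U l + V l != 0.
  by apply: ws_neq0; rewrite inE -reduce_sum_p l0 reduce0.
by rewrite -reduce_sum_3 l0 reduce0.
Qed.

(** Every residue modulo [3p] over a difference of [T] is a difference of the
    row of the extension that comes from that pair of [T]. *)
Lemma row_lift_difference (i : 'I_q) (d : 'Z_(3 * p)) :
  reduce p d = (tnth T i).1 - (tnth T i).2 -> exists l, d = a l - b l.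
Proof.
move=> d_p; have [rowUV _ _] := solUV.
have [k UVk] := row_difference i (reduce 3 d) rowUV.
exists (row_index i k); apply: reduce_inj; rewrite reduceB //.
- by rewrite d_p a_p b_p ext_difference.
- by rewrite -UVk a_3 b_3.
Qed.

Lemma mem_difference (d : 'Z_(3 * p)) :
    starter [set [set xy.1; xy.2] | xy in T] ->
  d != 0 -> exists l, d = a l - b l \/ - d = a l - b l.
Proof.
move=> T_starter d_neq0.
have [d_p|d_p] := eqVneq (reduce p d) 0; last first.
  have T_starter' :
      starter [set [set (tnth T i).1; (tnth T i).2] | i : 'I_q].
    suff -> : [set [set (tnth T i).1; (tnth T i).2] | i : 'I_q]
              = [set [set xy.1; xy.2] | xy in T] by [].
    apply/setP => B; apply/imsetP/imsetP => [[i _ ->]|[xy /tnthP[i ->] ->]].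
      by exists (tnth T i) => //; apply: mem_tnth.
    by exists i.
  have [i [d_i|d_i]] := starter_difference T_starter' d_p.
    by have [l ->] := row_lift_difference d_i; exists l; left.
  move: d_i; rewrite -reduceN // => d_i.
  by have [l ->] := row_lift_difference d_i; exists l; right.
(* Index 0 is the pair over (t, t). *)
have d_3 : reduce 3 d != 0.
  by apply: contraNneq d_neq0 => d_3; apply/eqP/reduce_inj.
have ab0_p : reduce p (a ord0 - b ord0) = 0 by rewrite reduceB // a_p b_p subrr.
have ab0_3 : reduce 3 (a ord0 - b ord0) != 0.
  apply/eqP => ab0_3.
  have /(@entry_lift_inj (ord0, false) (ord0, true)) // : a ord0 = b ord0.
  by apply/eqP; rewrite -subr_eq0; apply/eqP/reduce_inj.
exists ord0.
have [d_ab|d_ab] := Z3_neq0 d_3 ab0_3; [left | right]; apply: reduce_inj => //.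
- by rewrite ab0_p.
- by rewrite reduceN // d_p oppr0 ab0_p.
- by rewrite reduceN.
Qed.

End Lifting.

End Starters.

Theorem theorem1 (p q : nat) (hpq : p = (2 * q + 1)%N) (hp3 : (3 <= p)%N)
    (hcop : coprime p 3)
    (T : q.-tuple ('Z_p * 'Z_p)%type)
    (hT : strong_starter [set [set xy.1; xy.2] | xy in T])
    (t : 'Z_p)
    (U V : 'I_(3 * q).+1 -> 'Z_3)
    (hUV : sudoku_solution T t U V)
    (a b : 'I_(3 * q).+1 -> 'Z_(3 * p))
    (ha : forall i, (a i = ext_u T t i %[mod p])%N /\ (a i = U i %[mod 3])%N)
    (hb : forall i, (b i = ext_v T t i %[mod p])%N /\ (b i = V i %[mod 3])%N) :
  strong_starter [set [set a i; b i] | i : 'I_(3 * q).+1].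
Proof.
have p_gt1 : 1 < p := ltnW hp3.
have a_p l : reduce p (a l) = ext_u T t l by apply: reduceP; case: (ha l).
have a_3 l : reduce 3 (a l) = U l by apply: reduceP; case: (ha l).
have b_p l : reduce p (b l) = ext_v T t l by apply: reduceP; case: (hb l).
have b_3 l : reduce 3 (b l) = V l by apply: reduceP; case: (hb l).
have [T_starter _ _] := hT.
apply: strong_starter_imset.
- by rewrite oddM hpq oddD oddM.
- by rewrite (leq_trans hp3) // leq_pmull.
- by rewrite card_ord hpq mulnDr addn3 mulnCA mul2n /= doubleK.
- exact: (entry_lift_inj hUV a_p a_3 b_p b_3).
- exact: (entry_lift_neq0 hUV a_p a_3 b_p b_3).
- by move=> d; exact: (mem_difference p_gt1 hcop hUV a_p a_3 b_p b_3 T_starter).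
- exact: (sum_lift_inj p_gt1 hUV a_p a_3 b_p b_3).
- exact: (sum_lift_neq0 p_gt1 hUV a_p a_3 b_p b_3).
Qed.
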